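(* Let $\mathcal{C}$ be a class of $N$ subsets of $\{1,\ldots,n\}$, each of cardinality $K\ge 1$, and let $\mu>0$. Let $f:\mathbb{R}^n\to\{0,1\}$ be the averaging test, $f(\mathbf{x})=1$ if $\sum_{i=1}^n x_i>\mu K/2$ and $f(\mathbf{x})=0$ otherwise. Let $\delta>0$ (with $\delta\le 2$, so that the square root below is real). Then the risk of $f$ satisfies $R(f)\le\delta$ whenever $$\mu\ \ge\ \sqrt{\frac{8n}{K^2}\log\frac{2}{\delta}}.$$
   Context: Setting: $n\ge1$, and $\mathcal{C}=\{S_1,\ldots,S_N\}$ is a class of $N\ge 1$ distinct subsets of $\{1,\ldots,n\}$, all of the same cardinality $K$. One observes a random vector $\mathbf{X}=(X_1,\ldots,X_n)$. Under $\mathbb{P}_0$, the components of $\mathbf{X}$ are independent standard normal. For $S\in\mathcal{C}$, under $\mathbb{P}_S$ the components are independent with $X_i\sim\mathcal{N}(\mu,1)$ for $i\in S$ and $X_i\sim\mathcal{N}(0,1)$ for $i\notin S$, where $\mu>0$. A test is a (measurable) function $f:\mathbb{R}^n\to\{0,1\}$, and its risk is $$R(f)=\mathbb{P}_0\{f(\mathbf{X})=1\}+\frac1N\sum_{S\in\mathcal{C}}\mathbb{P}_S\{f(\mathbf{X})=0\}.$$ *)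

(* Defs.v *)
From HB Require Import structures.
From mathcomp Require Import all_boot all_order all_algebra.
From mathcomp Require Import all_classical all_reals all_analysis.
From mathcomp Require Import measurable_realfun.

Set Implicit Arguments.
Unset Strict Implicit.
Unset Printing Implicit Defensive.

Import Order.TTheory GRing.Theory Num.Theory.
Import numFieldNormedType.Exports.

Local Open Scope classical_set_scope.
Local Open Scope ring_scope.

(* R^n is [n.-tuple R], whose canonical sigma-algebra is the product one. *)

(* The observed vector is given by its components [X i : {mfun T >-> R}],
   which, unlike [{RV P >-> R}], does not tie it to one probability: the same
   observation is considered under several laws. *)

Definition mutually_independent d (T : measurableType d) (R : realType)
    (P : probability T R) n (X : 'I_n -> {mfun T >-> R}) : Prop :=
  forall (J : {set 'I_n}) (A : 'I_n -> set R),
    (forall i, measurable (A i)) ->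
    P (\bigcap_(i in [set` J]) (X i @^-1` A i)) =
    (\prod_(i in J) P (X i @^-1` A i))%E.

Definition independent_unit_normal d (T : measurableType d) (R : realType)
    (P : probability T R) n (X : 'I_n -> {mfun T >-> R})
    (m : 'I_n -> R) : Prop :=
  mutually_independent P X /\
  (* [normal_prob m s] is parametrized by the standard deviation [s] *)
  forall i (A : set R), measurable A ->
    distribution P (X i) A = normal_prob (m i) 1 A.

Definition shifted_mean (R : realType) n (mu : R) (S : {set 'I_n}) (i : 'I_n) : R :=
  if i \in S then mu else 0.

Definition test (R : realType) (n : nat) := {mfun n.-tuple R >-> bool}.

(* [PS S] is only meant to be constrained, and is only used, for [S \in C]. *)
Definition risk d (T : measurableType d) (R : realType) n
    (C : {set {set 'I_n}}) (P0 : probability T R)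
    (PS : {set 'I_n} -> probability T R) (X : 'I_n -> {mfun T >-> R})
    (f : test R n) : \bar R :=
  (P0 [set w | f [tuple X i w | i < n] = true] +
   (#|C|%:R^-1)%:E *
     \sum_(S in C) PS S [set w | f [tuple X i w | i < n] = false])%E.

Definition averaging_test (R : realType) (n K : nat) (mu : R)
    (x : n.-tuple R) : bool :=
  mu * K%:R / 2 < \sum_(i < n) tnth x i.

Lemma measurable_averaging_test (R : realType) (n K : nat) (mu : R) :
  measurable_fun [set: n.-tuple R] (@averaging_test R n K mu).
Proof.
apply: measurable_fun_ltr => //.
apply: measurable_sum => i; exact: measurable_tnth.
Qed.

HB.instance Definition _ (R : realType) (n K : nat) (mu : R) :=
  isMeasurableFun.Build _ _ (n.-tuple R) bool (@averaging_test R n K mu)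
    (measurable_averaging_test K mu).

(* Main.v *)
Require Import Defs.
From HB Require Import structures.
From mathcomp Require Import all_boot all_order all_algebra.
From mathcomp Require Import all_classical all_reals all_analysis.
From mathcomp Require Import measurable_realfun ring lra.

Import Order.TTheory GRing.Theory Num.Theory.

(** Chernoff's method. Under each of the laws, the centered sum of the
    components has moment generating function [exp (n r ^ 2 / 2)], by
    independence, so that it exceeds [mu K / 2] in a given direction with
    probability at most [exp (- (mu K) ^ 2 / (8 n)) <= delta / 2]. Since the
    sum has mean [0] under [P0] and [mu K] under every [PS S], the threshold
    [mu K / 2] is at distance [mu K / 2] from both means, and the two halves
    of the risk are at most [delta / 2] each. *)

Local Open Scope ring_scope.

Section chernoff_for_sums.
Local Open Scope classical_set_scope.

Section weight.
Import HBNNSimple.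
Local Open Scope ereal_scope.

(** With [X = id], [Y] is a density of [nu] with respect to [mu]. With [nu] the
    law of [X], the hypothesis says that [Y] is uncorrelated with every event
    [X @^-1` A], and the conclusion that [f \o X] can be factored out. *)
Lemma ge0_integral_comp_weight (R : realType) (d d' : measure_display)
    (T : measurableType d) (T' : measurableType d')
    (mu : {measure set T -> \bar R}) (nu : {measure set T' -> \bar R})
    (D : set T) (X : T -> T') (Y : T -> R) (c : R) (f : T' -> R) :
  measurable D -> measurable_fun setT X ->
  measurable_fun setT Y -> (forall x, (0 <= Y x)%R) -> (0 <= c)%R ->
  measurable_fun setT f -> (forall y, (0 <= f y)%R) ->
  (forall A, measurable A ->
    \int[mu]_(x in D `&` X @^-1` A) (Y x)%:E = c%:E * nu A) ->
  \int[mu]_(x in D) (f (X x) * Y x)%:E = c%:E * \int[nu]_y (f y)%:E.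
Proof.
move=> mD mX mY Y0 c0 mf f0 H.
have mEf : measurable_fun setT (EFin \o f) by exact/measurable_EFinP.
have Ef0 y : setT y -> 0 <= (EFin \o f) y by rewrite lee_fin.
(* By monotone convergence on both sides, which the nonnegativity of [Y] allows on the left, it is
   enough to treat the simple functions [g n] increasing to [f]. *)
pose g := nnsfun_approx measurableT mEf.
have gf y : (g n y)%:E @[n --> \oo] --> (f y)%:E.
  exact: (cvg_nnsfun_approx _ _ Ef0).
have ndg y : nondecreasing_seq (g^~ y).
  by move=> m n mn; exact/lefP/nd_nnsfun_approx.
have mpre B : measurable B -> measurable (X @^-1` B).
  by move=> mB; rewrite -[_ @^-1` _]setTI; exact: mX.
rewrite (@nd_ge0_integral_lim _ _ _ nu (EFin \o f) g)//.
rewrite -limeMl//; last exact: is_cvg_sintegral.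
have cvgfY x : (g n (X x) * Y x)%:E @[n --> \oo] --> (f (X x) * Y x)%:E.
  under eq_fun do rewrite EFinM.
  by rewrite EFinM; apply: cvgeZr.
transitivity (limn (fun n => \int[mu]_(x in D) (g n (X x) * Y x)%:E)).
  rewrite -monotone_convergence//.
  - by apply: eq_integral => x _; apply/esym/cvg_lim => //; exact: cvgfY.
  - move=> n; apply/measurable_EFinP/measurable_funTS/measurable_funM => //.
    exact: measurableT_comp.
  - by move=> n x _; rewrite lee_fin mulr_ge0.
  - by move=> x _ m n mn; rewrite lee_fin ler_wpM2r// ndg.
apply: congr_lim; apply/funext => n /=.
rewrite sintegralE ge0_mule_fsumr; last exact: nnsfun_mulemu_ge0.
transitivity (\sum_(y \in range (g n))
    \int[mu]_(x in D) (y * (\1_(X @^-1` (g n @^-1` [set y])) x * Y x))%:E).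
  rewrite -ge0_integral_fsum//.
  - apply: eq_integral => x _; rewrite fsumEFin//; congr EFin.
    by rewrite fimfunE mulr_fsuml; apply: eq_fsbigr => y _; rewrite -mulrA.
  - move=> y; apply/measurable_EFinP/measurable_funTS.
    do 2 apply: measurable_funM => //.
    by apply/measurable_indic/mpre; exact: measurable_sfunP.
  - move=> y x _; rewrite mulrA EFinM mule_ge0 ?lee_fin//.
    exact: (nnfun_muleindic_ge0 (g n) y (X x)).
(* On one level set, [H] applies with [A] the set where [g n] equals [y]; the indicator is absorbed
   into the domain of integration. *)
apply: eq_fsbigr => y /set_mem[z _ gz].
rewrite muleCA -H//.
under eq_integral do rewrite EFinM.
rewrite ge0_integralZl_EFin//.
- congr (_ * _); rewrite integral_mkcondr.
  apply: eq_integral => x _; rewrite patchE indicE.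
  by case: ifPn; rewrite ?mul1r ?mul0r.
- by move=> x _; rewrite lee_fin mulr_ge0.
- apply/measurable_EFinP/measurable_funTS/measurable_funM => //.
  by apply/measurable_indic/mpre; exact: measurable_sfunP.
- by rewrite -gz.
Qed.

End weight.

Lemma mutually_independent_integral_prod (R : realType) (n : nat)
    (d : measure_display) (T : measurableType d) (P : probability T R)
    (X : 'I_n -> {mfun T >-> R}) (f : 'I_n -> R -> R) (e : 'I_n -> R) :
  mutually_independent P X ->
  (forall i, measurable_fun setT (f i)) -> (forall i y, 0 <= f i y) ->
  (forall i, \int[P]_x (f i (X i x))%:E = (e i)%:E)%E ->
  (\int[P]_x (\prod_i f i (X i x))%:E = (\prod_i e i)%:E)%E.
Proof.
move=> indep mf f0 He.
have e0 i : 0 <= e i.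
  by rewrite -lee_fin -He; apply: integral_ge0 => x _; rewrite lee_fin.
have mX i A : measurable A -> measurable (X i @^-1` A).
  by move=> mA; exact: measurable_funPTI.
have mprod (s : seq 'I_n) :
    measurable_fun setT (fun x => \prod_(i <- s) f i (X i x)).
  by apply: measurable_prod => i _; exact: measurableT_comp.
(* This interpolates between independence ([s] empty) and the goal ([J] empty). In the induction on
   [s], its head [a] moves into [J] with an arbitrary event [B], which is the hypothesis of the
   weight lemma for [X a]. *)
suff H (s : seq 'I_n) (J : {set 'I_n}) (A : 'I_n -> set R) :
    uniq s -> {in s, forall i, i \notin J} -> (forall i, measurable (A i)) ->
    (\int[P]_(x in \bigcap_(i in [set` J]) (X i @^-1` A i))
       (\prod_(i <- s) f i (X i x))%:E =
     (\prod_(i <- s) e i)%:E * \prod_(i in J) P (X i @^-1` A i))%E.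
  have := H (index_enum 'I_n) finset.set0 (fun=> setT) (index_enum_uniq _).
  rewrite big_set0 mule1 => <- //; last by move=> i _; rewrite finset.in_set0.
  by congr integral; apply/seteqP; split=> // x _ i.
elim: s J A => [|a s IH] J A /=.
  move=> _ _ mA; under eq_integral do rewrite big_nil.
  rewrite integral_cst ?mul1e ?big_nil ?mul1e.
    exact: indep.
  by apply: fin_bigcap_measurable => // i _; exact: mX.
move=> /andP[a_s s_uniq] sJ mA.
under eq_integral do rewrite big_cons.
rewrite big_cons.
have aJ : a \notin J by apply: sJ; rewrite mem_head.
(* The constant of the weight lemma is a real number, so the product of probabilities has to be
   one. *)
have [p p0 EJ] : exists2 p : R, 0 <= p & (\prod_(i in J) P (X i @^-1` A i))%E = p%:E.
  exists (\prod_(i in J) fine (P (X i @^-1` A i))).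
    by apply: prodr_ge0 => i _; exact: fine_ge0.
  by rewrite -prodEFin; apply: eq_bigr => i _; rewrite fineK// fin_num_measure//; exact: mX.
rewrite EJ -EFinM (_ : (e a * _ * p)%:E = ((\prod_(i <- s) e i) * p)%:E *
    \int[distribution P (X a)]_y (f a y)%:E)%E; last first.
  rewrite ge0_integral_distribution//.
  - by rewrite He -EFinM; congr EFin; ring.
  - exact/measurable_EFinP.
  - by move=> y; rewrite lee_fin.
apply: ge0_integral_comp_weight => //.
- by apply: fin_bigcap_measurable => // i _; exact: mX.
- by move=> x; exact: prodr_ge0.
- by rewrite mulr_ge0// prodr_ge0.
move=> B mB.
pose A' i := if i == a then B else A i.
have A'J i : i \in J -> A' i = A i.
  by rewrite /A'; case: eqVneq => // ->; rewrite (negbTE aJ).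
have -> : \bigcap_(i in [set` J]) X i @^-1` A i `&` X a @^-1` B =
    \bigcap_(i in [set` a |: J]) X i @^-1` A' i.
  apply/seteqP; split => x /=.
    move=> [AJ XaB] i /=; rewrite finset.in_setU1 => /orP[/eqP->|iJ].
      by rewrite /A' eqxx.
    by rewrite A'J//; exact: AJ.
  move=> A'x; split.
    by move=> i /= iJ; rewrite -A'J//; apply: A'x; rewrite /= finset.in_setU1 iJ orbT.
  by have := A'x a; rewrite /A' /= eqxx; apply; rewrite finset.setU11.
rewrite IH//.
- rewrite big_setU1//= (_ : A' a = B); last by rewrite /A' eqxx.
  rewrite (eq_bigr (fun i => P (X i @^-1` A i))) => [|i iJ]; last by rewrite A'J.
  by rewrite EJ [in RHS]EFinM -[in RHS]muleA [(p%:E * _)%E in RHS]muleC.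
- move=> i si; rewrite finset.in_setU1 negb_or sJ ?in_cons ?si ?orbT// andbT.
  by apply: contraNneq a_s => <-.
- by move=> i; rewrite /A'; case: ifP.
Qed.

(** Completing the square: exponential tilting by [r] shifts the mean by [r]. *)
Lemma expR_mul_normal_pdf (R : realType) (m r x : R) :
  expR (r * (x - m)) * normal_pdf m 1 x =
  expR (r ^+ 2 / 2) * normal_pdf (m + r) 1 x.
Proof.
rewrite !normal_pdfE ?oner_eq0// /normal_fun.
rewrite mulrCA [RHS]mulrCA -!expRD; congr (_ * expR _).
by field.
Qed.

Lemma normal_law_centered_mgf (R : realType) (nu : {measure set R -> \bar R})
    (m r : R) :
  (forall A, measurable A -> nu A = normal_prob m 1 A) ->
  (\int[nu]_x (expR (r * (x - m)))%:E = (expR (r ^+ 2 / 2))%:E)%E.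
Proof.
move=> nuE.
have mE : measurable_fun setT (fun x : R => expR (r * (x - m))).
  apply: measurableT_comp => //; apply: measurable_funM => //.
  exact: measurable_funB.
(* The factor 1 is the constant of the weight lemma, used with [X = id] and the normal density as
   weight. After tilting, what remains is a density, of integral 1. *)
rewrite -[LHS]mul1e.
rewrite -(@ge0_integral_comp_weight R _ _ _ _ lebesgue_measure nu
  setT id (normal_pdf m 1) 1 (fun x => expR (r * (x - m))))//=.
- under eq_integral do rewrite expR_mul_normal_pdf EFinM.
  rewrite ge0_integralZl//= ?integral_normal_pdf ?mule1//.
  + apply/measurable_EFinP; exact: measurable_normal_pdf.
  + by move=> x _; rewrite lee_fin normal_pdf_ge0.
- exact: measurable_normal_pdf.
- exact: normal_pdf_ge0.
- by move=> A mA; rewrite setTI mul1e nuE.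
Qed.

(** The sign [c] is 1 or -1, so that one statement serves both tails; letting [E] be any event
    inside the tail covers strict and large inequalities alike. *)
Lemma independent_unit_normal_tail (R : realType) (n : nat)
    (d : measure_display) (T : measurableType d) (P : probability T R)
    (X : 'I_n -> {mfun T >-> R}) (m : 'I_n -> R) (c a : R) (E : set T) :
  (0 < n)%N -> independent_unit_normal P X m -> c ^+ 2 = 1 -> 0 < a ->
  measurable E -> (forall w, E w -> a <= c * \sum_i (X i w - m i)) ->
  (P E <= (expR (- (a ^+ 2 / (2 * n%:R))))%:E)%E.
Proof.
move=> n0 [indep lawX] c1 a0 mE EP.
have n0R : n%:R != 0 :> R by rewrite pnatr_eq0 -lt0n.
have mS : measurable_fun setT (fun w => c * \sum_i (X i w - m i)).
  apply: measurable_funM => //; apply: measurable_sum => i.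
  exact: measurable_funB.
pose Smix := isMeasurableFun.Build _ _ _ _ _ mS.
pose S : {mfun T >-> R} := HB.pack (fun w => c * \sum_i (X i w - m i)) Smix.
(* This [r] minimizes the Chernoff exponent [n r ^ 2 / 2 - r a], with minimum [- a ^ 2 / (2 n)]. *)
set r := a / n%:R.
have r0 : 0 < r by rewrite divr_gt0// ltr0n.
apply: (@le_trans _ _ (P [set w | a <= S w])).
  apply: le_measure => //; rewrite inE//.
  by rewrite -[X in measurable X]setTI; apply: measurable_fun_le.
apply: (le_trans (@chernoff _ _ _ P S r a r0)).
have -> : ('M_ P S r = (\prod_(i < n) expR ((r * c) ^+ 2 / 2))%:E)%E.
  rewrite -(@mutually_independent_integral_prod R n _ T P X
    (fun i x => expR (r * c * (x - m i))))//.
  - rewrite /mmt_gen_fun unlock; apply: eq_integral => w _ /=.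
    by rewrite -expR_sum -mulr_sumr mulrC mulrA.
  - move=> i; apply: measurableT_comp => //; apply: measurable_funM => //.
    exact: measurable_funB.
  - move=> i.
    rewrite -(normal_law_centered_mgf R (distribution P (X i)) (m i))//.
    rewrite ge0_integral_distribution//=.
    + apply/measurable_EFinP; apply: measurableT_comp => //.
      by apply: measurable_funM => //; exact: measurable_funB.
    + exact: lawX.
rewrite prodr_const card_ord -expRM_natl -EFinM -expRD lee_fin ler_expR.
rewrite exprMn c1 /r le_eqVlt; apply/orP; left; apply/eqP; field.
by rewrite n0R.
Qed.

Lemma sum_shifted_mean (R : realType) (n : nat) (mu : R) (S : {set 'I_n}) :
  \sum_i shifted_mean mu S i = mu * #|S|%:R.
Proof.
by rewrite /shifted_mean -big_mkcond/= sumr_const mulr_natr.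
Qed.

End chernoff_for_sums.

Theorem proposition2p1 (R : realType) (n K : nat) (hn : (1 <= n)%N)
    (hK : (1 <= K)%N)
    (C : {set {set 'I_n}}) (hN : (1 <= #|C|)%N)
    (hC : forall S : {set 'I_n}, S \in C -> #|S| = K)
    (mu : R) (hmu : 0 < mu)
    (d : measure_display) (T : measurableType d)
    (X : 'I_n -> {mfun T >-> R})
    (P0 : probability T R) (PS : {set 'I_n} -> probability T R)
    (hP0 : independent_unit_normal P0 X (fun=> 0))
    (hPS : forall S : {set 'I_n}, S \in C ->
      independent_unit_normal (PS S) X (shifted_mean mu S))
    (delta : R) (hdelta0 : 0 < delta) (hdelta2 : delta <= 2)
    (hbound : Num.sqrt (8 * n%:R / K%:R ^+ 2 * ln (2 / delta)) <= mu) :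
  (risk C P0 PS X (@averaging_test R n K mu) <= delta%:E)%E.
Proof.
have K0 : 0 < K%:R :> R by rewrite ltr0n.
have n0 : 0 < n%:R :> R by rewrite ltr0n.
pose a : R := mu * K%:R / 2.
have a0 : 0 < a by rewrite divr_gt0 ?mulr_gt0.
(* Since [a = mu K / 2], the exponent is [(mu K) ^ 2 / (8 n)], and [hbound] squared says that it is
   at least [ln (2 / delta)]. *)
have tail_le : ((expR (- (a ^+ 2 / (2 * n%:R))))%:E <= (delta / 2)%:E)%E.
  rewrite lee_fin.
  rewrite -[leRHS]lnK ?posrE ?divr_gt0// ler_expR.
  have -> : ln (delta / 2) = - ln (2 / delta).
    by rewrite -lnV ?posrE ?divr_gt0// invf_div.
  rewrite lerN2 /a.
  have ln0 : 0 <= ln (2 / delta) by rewrite ln_ge0// ler_pdivlMr// mul1r.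
  have : 8 * n%:R / K%:R ^+ 2 * ln (2 / delta) <= mu ^+ 2.
    by rewrite -ler_sqrt ?sqr_ge0// sqrtr_sqr gtr0_norm.
  rewrite mulrAC ler_pdivrMr ?exprn_gt0// => H.
  rewrite ler_pdivlMr ?mulr_gt0//; nra.
pose sumX w : R := \sum_i X i w.
have mX : measurable_fun setT sumX by apply: measurable_sum => i.
have testE w : @averaging_test R n K mu [tuple X i w | i < n] = (a < sumX w).
  by rewrite /averaging_test; under eq_bigr do rewrite tnth_mktuple.
have mle : measurable [set w | sumX w <= a]%classic.
  by rewrite -[X in measurable X]setTI; apply: measurable_fun_le.
have mlt : measurable [set w | a < sumX w]%classic.
  rewrite [X in measurable X](_ : _ = ~` [set w | sumX w <= a])%classic.
    exact: measurableC.
  by apply/seteqP; split=> w /=; rewrite ltNge => /negP.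
rewrite /risk.
have -> : [set w | @averaging_test R n K mu [tuple X i w | i < n] = true]%classic =
    [set w | a < sumX w]%classic.
  by apply/seteqP; split=> w /=; rewrite testE.
have -> : [set w | @averaging_test R n K mu [tuple X i w | i < n] = false]%classic =
    [set w | sumX w <= a]%classic.
  by apply/seteqP; split=> w /=; rewrite testE leNgt; [move/negbT|move/negbTE].
rewrite (_ : delta = delta / 2 + delta / 2); last by rewrite -splitr.
rewrite EFinD; apply: leeD.
  apply: le_trans tail_le.
  apply: (independent_unit_normal_tail _ _ _ _ _ X (fun=> 0) 1) => //.
  - by rewrite expr1n.
  - move=> w /= /ltW; rewrite mul1r => /le_trans; apply.
    by under [leRHS]eq_bigr do rewrite subr0.
(* Clearing the factor [1 / #|C|] turns the bound into [#|C|] copies of [delta / 2], compared term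
   by term. *)
rewrite lee_pdivrMl ?ltr0n// -EFinM mulr_natl -sumr_const -sumEFin.
apply: lee_sum => S SC.
apply: le_trans tail_le.
apply: (independent_unit_normal_tail _ _ _ _ _ X (shifted_mean mu S) (- 1)) => //.
- exact: hPS.
- by rewrite sqrrN expr1n.
(* The mean is [mu K = 2 a], so a sum of at most [a] falls short of it by at least [a]: the lower
   tail. *)
- move=> w /=; rewrite sumrB sum_shifted_mean hC// -/(sumX w) /a => ?; lra.
Qed.
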